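(* Let $e_1,\dots,e_m$ be any multigraph edge stream, $\alpha,\beta\in(0,1)$, $\Delta t\ge0$, and run MG-Triangle$(\alpha,\beta,\Delta t)$ as described in the context. For every time $t$, the output $\widehat T_t$ satisfies $\mathbf E[\widehat T_t]=|T_t|$, where $T_t$ is the set of triangles of the simple graph $G_t$ formed by the edges $e_s$, $\max(1,t-\Delta t)\le s\le t$.
   Context: A multigraph edge stream is a sequence $e_1,\dots,e_m$ of unordered pairs of distinct vertex ids; the same pair may occur several times. For $t'\le t$, $G[t',t]$ denotes the simple undirected graph whose edge set is the set of distinct pairs among $e_{t'},\dots,e_t$; $G_t=G[\max(1,t-\Delta t),t]$. A wedge is a path of length $2$, i.e. an unordered pair of distinct edges $\{(u,v),(u,w)\}$ sharing exactly one vertex $u$; its closing edge is $(v,w)$. $W_t$ and $T_t$ denote the sets of wedges and triangles of $G_t$. $hash$ is a uniformly random function assigning to every edge and every wedge an independent uniform value in $(0,1)$; expectations are over $hash$ only. Algorithm MG-Triangle$(\alpha,\beta,\Delta t)$ keeps a set \textit{e-list} of edges, a set \textit{w-list} of wedges, and for each $w\in$ \textit{w-list} a bit $X_w$; all start empty. For each $t=1,\dots,m$, on seeing $e_t$: (1) Update: if $hash(e_t)\le\alpha$ and $e_t\notin$ \textit{e-list}, insert $e_t$ into \textit{e-list}, and for each wedge $w=\{e,e_t\}$ with $e\in$ \textit{e-list}, if $hash(w)\le\beta$ and $w\notin$ \textit{w-list}, insert $w$ into \textit{w-list} (with $X_w=0$). (2) For each $w=\{(u,v),(u,w')\}\in$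 \textit{w-list}: if $e_t$ is the closing edge $(v,w')$ set $X_w=1$; else if $e_t\in\{(u,v),(u,w')\}$ reset $X_w=0$. (3) Let $\mathcal W$ be the set of wedges in \textit{w-list} that belong to $W_t$; output $\widehat T_t=(\alpha^2\beta)^{-1}\sum_{w\in\mathcal W}X_w$, $\widehat W_t=(\alpha^2\beta)^{-1}|\mathcal W|$, and $\widehat\tau_t=3\widehat T_t/\widehat W_t$ (with $\widehat\tau_t=0$ if $\widehat W_t=0$). *)

(* Defs.v *)
From HB Require Import structures.
From mathcomp Require Import all_boot all_order all_algebra.
From mathcomp Require Import finmap.
From mathcomp Require Import all_classical all_reals all_analysis.

Set Implicit Arguments.
Unset Strict Implicit.
Unset Printing Implicit Defensive.

Import Order.TTheory GRing.Theory Num.Theory.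

Local Open Scope fset_scope.
Local Open Scope ring_scope.

Record edge (V : choiceType) := Edge {
  endpoints :> {fset V};
  _ : #|` endpoints| == 2%N }.

HB.instance Definition _ (V : choiceType) := [isSub for @endpoints V].
HB.instance Definition _ (V : choiceType) := [Choice of edge V by <:].

(* [s] is the pair of edges {(u,v), (u,v')}.  Since an [edge] has two distinct
   endpoints, [v != v'] makes the two edges distinct with only [u] in common. *)
Definition path2 (V : choiceType) (s : {fset edge V}) (u v v' : V) : Prop :=
  v != v' /\
  exists e f : edge V,
    [/\ endpoints e = [fset u; v], endpoints f = [fset u; v'] & s = [fset e; f]].

Record wedge (V : choiceType) := Wedge {
  wedge_edges :> {fset edge V};
  _ : `[< exists u v v', path2 wedge_edges u v v' >] }.

HB.instance Definition _ (V : choiceType) := [isSub for @wedge_edges V].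
HB.instance Definition _ (V : choiceType) := [Choice of wedge V by <:].

Definition closes (V : choiceType) (c : edge V) (w : wedge V) : bool :=
  `[< exists u v v', path2 w u v v' /\ endpoints c = [fset v; v'] >].

(* Stream positions are counted from 1: the edge set of G[t', t]. *)
Definition graph_between (V : choiceType) (s : seq (edge V)) (t' t : nat) :
    {fset edge V} :=
  [fset e in drop t'.-1 (take t s)].

Definition window_graph (V : choiceType) (s : seq (edge V)) (dt t : nat) :
    {fset edge V} :=
  graph_between s (maxn 1 (t - dt)) t.

Definition adjacent (V : choiceType) (G : {fset edge V}) (x y : V) : bool :=
  has (fun e : edge V => endpoints e == [fset x; y]) G.

Definition triangles (V : choiceType) (G : {fset edge V}) : {fset {fset V}} :=
  [fset A in fpowerset (\bigcup_(e <- G) endpoints e) |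
    (#|` A| == 3%N) &&
    [forall x : A, forall y : A, (x != y) ==> adjacent G (val x) (val y)]].

Definition wedge_of_graph (V : choiceType) (G : {fset edge V}) (w : wedge V) :
    bool :=
  wedge_edges w `<=` G.

(* [bit st w] is X_w; it is meaningful only for [w] in [wlist st]. *)
Record state (V : choiceType) := State {
  elist : {fset edge V};
  wlist : {fset wedge V};
  bit : wedge V -> bool }.

Definition init_state (V : choiceType) : state V :=
  State fset0 fset0 (fun=> false).

(* The hash of an edge [e] is [h (inl e)], that of a wedge [w] is [h (inr w)]. *)
Definition hash_fun (R : realType) (V : choiceType) :=
  (edge V + wedge V)%type -> R.

(* [insub] discards the pairs {e, x} that are not wedges. *)
Definition wedges_through (V : choiceType) (es : {fset edge V}) (x : edge V) :
    {fset wedge V} :=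
  [fset w in pmap insub [seq [fset e; x] | e <- es]].

Definition update (R : realType) (V : choiceType) (h : hash_fun R V)
    (alpha beta : R) (st : state V) (x : edge V) : state V :=
  if (h (inl x) <= alpha) && (x \notin elist st) then
    let es := x |` elist st in
    let new := [fset w in wedges_through es x |
                 (h (inr w) <= beta) && (w \notin wlist st)] in
    State es (wlist st `|` new)
      (fun w => if w \in new then false else bit st w)
  else st.

Definition set_bits (V : choiceType) (st : state V) (x : edge V) : state V :=
  State (elist st) (wlist st)
    (fun w => if w \notin wlist st then bit st w
              else if closes x w then true
              else if x \in wedge_edges w then false
              else bit st w).

Definition step (R : realType) (V : choiceType) (h : hash_fun R V)
    (alpha beta : R) (st : state V) (x : edge V) : state V :=
  set_bits (update h alpha beta st x) x.

Definition state_at (R : realType) (V : choiceType) (h : hash_fun R V)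
    (alpha beta : R) (s : seq (edge V)) (t : nat) : state V :=
  foldl (step h alpha beta) (init_state V) (take t s).

Definition sampled_wedges (R : realType) (V : choiceType) (h : hash_fun R V)
    (alpha beta : R) (dt : nat) (s : seq (edge V)) (t : nat) : {fset wedge V} :=
  [fset w in wlist (state_at h alpha beta s t) |
    wedge_of_graph (window_graph s dt t) w].

Definition That (R : realType) (V : choiceType) (h : hash_fun R V)
    (alpha beta : R) (dt : nat) (s : seq (edge V)) (t : nat) : R :=
  (alpha ^+ 2 * beta)^-1 *
  \sum_(w <- sampled_wedges h alpha beta dt s t)
     (bit (state_at h alpha beta s t) w)%:R.

Definition mutually_independent (d : measure_display) (Omega : measurableType d)
    (R : realType) (P : probability Omega R) (I : choiceType)
    (X : I -> {RV P >-> R}) : Prop :=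
  forall (J : {fset I}) (A : I -> set R),
    (forall i, measurable (A i)) ->
    P (\bigcap_(i in [set` J]) (X i @^-1` A i))%classic =
    (\prod_(i <- J) P (X i @^-1` A i)%classic)%E.

(* [uniform_prob] is the uniform law on [0, 1], which does not charge 0 and 1. *)
Definition uniform01 (d : measure_display) (Omega : measurableType d)
    (R : realType) (P : probability Omega R) (X : {RV P >-> R}) : Prop :=
  forall A : set R, measurable A ->
    distribution P X A = uniform_prob (@ltr01 R) A.

Definition random_hash (d : measure_display) (Omega : measurableType d)
    (R : realType) (P : probability Omega R) (V : choiceType)
    (hash : (edge V + wedge V)%type -> {RV P >-> R}) : Prop :=
  mutually_independent hash /\ forall k, uniform01 (hash k).

(* Main.v *)
Require Import Defs.
From HB Require Import structures.
From mathcomp Require Import all_boot all_order all_algebra.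
From mathcomp Require Import finmap.
From mathcomp Require Import all_classical all_reals all_analysis.
From mathcomp Require Import measurable_realfun.

(* A wedge [w] contained in the stream prefix is stored exactly when the hashes
   of its two edges are at most alpha and its own hash is at most beta, which by
   independence has probability alpha^2 beta.  For a stored wedge, the bit X_w
   says that the closing edge of [w] occurred more recently than both edges of
   [w]; it does not depend on the hashes, because the insertion of [w] happens
   at an occurrence of one of its edges.  In every triangle of the window graph
   exactly one edge has the most recent last occurrence, so exactly one of its
   three wedges has this property, and conversely the closing edge of such a
   wedge of the window graph lies in the window. *)

Set Implicit Arguments.
Unset Strict Implicit.
Unset Printing Implicit Defensive.

Import Order.TTheory GRing.Theory Num.Theory.

Local Open Scope fset_scope.
Local Open Scope ring_scope.

(** * Wedges, their closing edges, and which of these occurred last in a stream *)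

Section Wedges.
Variable V : choiceType.
Implicit Types (e f c x : edge V) (w : wedge V) (G : {fset edge V}).

Lemma edge_neq e (u v : V) : endpoints e = [fset u; v] -> u != v.
Proof. by case: e => /= A + eA; rewrite eA cardfs2; case: (u != v). Qed.

Lemma edge_inj e f : endpoints e = endpoints f -> e = f.
Proof. exact: val_inj. Qed.

Lemma wedgeP w : exists u v v', path2 w u v v'.
Proof. by case: w => A /= /asboolP. Qed.

Lemma fset2_eq (T : choiceType) (a b a' b' : T) :
  [fset a; b] = [fset a'; b'] -> a != b ->
  (a = a' /\ b = b') \/ (a = b' /\ b = a').
Proof.
move=> E ab.
have := fset21 a b; rewrite E !inE => /orP[] /eqP Ea.
  have := fset22 a b; rewrite E !inE => /orP[] /eqP Eb; last by left.
  by rewrite Ea Eb eqxx in ab.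
have := fset22 a b; rewrite E !inE => /orP[] /eqP Eb; first by right.
by rewrite Ea Eb eqxx in ab.
Qed.

(* The far endpoints of a 2-path form the symmetric difference of its edges. *)
Lemma path2_far_ends (s : {fset edge V}) (u v v' u1 v1 v1' : V) :
  path2 s u v v' -> path2 s u1 v1 v1' -> [fset v; v'] = [fset v1; v1'].
Proof.
have symdiff (a b b' y : V) e f : b != b' -> endpoints e = [fset a; b] ->
    endpoints f = [fset a; b'] ->
    (y \in [fset b; b']) = (y \in endpoints e) (+) (y \in endpoints f).
  move=> bb' eE fE; rewrite eE fE !inE.
  have := edge_neq eE; have := edge_neq fE.
  have [->|_] := eqVneq y a; first by do 2 move=> /negbTE->.
  have [->|_] := eqVneq y b; first by rewrite (negbTE bb').
  by [].
move=> [vv' [e [f [eE fE sE]]]] [vv1' [e1 [f1 [e1E f1E s1E]]]].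
apply/fsetP => y; rewrite (symdiff _ _ _ _ _ _ vv' eE fE).
rewrite (symdiff _ _ _ _ _ _ vv1' e1E f1E).
have ef : e != f.
  apply/eqP => ef; have := symdiff _ _ _ v _ _ vv' eE fE.
  by rewrite ef addbb !inE eqxx.
by rewrite sE in s1E; have [[-> ->]|[-> ->]] := fset2_eq s1E ef; rewrite // addbC.
Qed.

(** [closes] quantifies over all presentations of [w] as a 2-path. They share the same far
    endpoints, so any single presentation decides. *)
Lemma closesE c w (u v v' : V) :
  path2 w u v v' -> closes c w = (endpoints c == [fset v; v']).
Proof.
move=> wP; apply/asboolP/eqP => [[a [b [b' [wP' ->]]]]|cE].
  exact: path2_far_ends wP' wP.
by exists u, v, v'.
Qed.

(** A wedge has exactly two edges, so one that contains [x] is [[fset e; x]] with [e] its other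
    edge. *)
Lemma in_wedges_through G x w : x \in G ->
  (w \in wedges_through G x) = (x \in wedge_edges w) && (wedge_edges w `<=` G).
Proof.
move=> xG; rewrite inE mem_pmap; apply/mapP/andP => [[s /mapP[e eG ->]]|].
  case: insubP => // w' _ wE [ww']; rewrite ww' wE /=.
  by rewrite fset22 fsubUset !fsub1set xG; split=> //; rewrite andbT.
move=> [xw /fsubsetP wG]; exists (val w); last by rewrite valK.
have [u [v [v' [vv' [e [f [eE fE wE]]]]]]] := wedgeP w.
move: (wG e) (wG f) xw; rewrite /= wE fset21 fset22 => /(_ isT) eG /(_ isT) fG.
rewrite !inE => /orP[]/eqP->; apply/mapP; last by exists e.
by exists f; rewrite // fsetUC.
Qed.

(* Read on the reversed stream: the first edge met among the edges of [w] and
   its closing edge is the closing one. *)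
Fixpoint first_closed w (r : seq (edge V)) : bool :=
  if r is x :: r' then
    if closes x w then true
    else if x \in wedge_edges w then false
    else first_closed w r'
  else false.

Definition last_closed w (p : seq (edge V)) : bool := first_closed w (rev p).

Lemma last_closed_rcons w p x : last_closed w (rcons p x) =
  if closes x w then true
  else if x \in wedge_edges w then false else last_closed w p.
Proof. by rewrite /last_closed rev_rcons. Qed.

(** Reading backwards, an edge of [w] in [q] settles the value at the latest, before [p] is
    reached. *)
Lemma last_closed_cat w p q : has (mem (wedge_edges w)) q ->
  last_closed w (p ++ q) = last_closed w q.
Proof.
rewrite /last_closed rev_cat -has_rev; elim: (rev q) => //= x r IH.
by case: (x \in _) => //= /IH->.
Qed.

End Wedges.

Lemma in_fset_sep (K : choiceType) (A : {fset K}) (P : pred K) (x : K) :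
  (x \in [fset y in A | P y]) = (x \in A) && P x.
Proof. by rewrite !inE. Qed.

(** * The state after a stream prefix, in closed form *)

Section Run.
Variables (R : realType) (V : choiceType) (h : hash_fun R V) (alpha beta : R).
Implicit Types (p : seq (edge V)) (w : wedge V).

Definition sampled w : bool :=
  all (fun e => h (inl e) <= alpha) (wedge_edges w) && (h (inr w) <= beta).

Let run p := foldl (step h alpha beta) (init_state V) p.

Lemma run_elist p e : (e \in elist (run p)) = (e \in p) && (h (inl e) <= alpha).
Proof.
elim/last_ind: p e => // p x + e; rewrite /run foldl_rcons -/(run p) /= => IH.
rewrite /update mem_rcons in_cons; case: ifPn => /= [/andP[hx _]|].
  by rewrite !inE IH; case: eqP => //= ->; rewrite hx.
(* Here the update was skipped: either the hash of [x] exceeds [alpha], or [x] is already listed and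
   hence occurs in [p]. *)
rewrite (IH e); case: eqP => //= ->.
by rewrite negb_and negbK IH => /orP[/negbTE->|/andP[-> ->]]; rewrite ?andbF.
Qed.

(** A wedge with small enough hash is inserted at the moment when the second of its edges enters
    [elist], and nothing is ever removed. *)
Lemma run_wlist p w : (w \in wlist (run p)) =
  (wedge_edges w `<=` elist (run p)) && (h (inr w) <= beta).
Proof.
elim/last_ind: p => [|p x].
  rewrite /= !inE; have [u [v [v' [_ [e [f [_ _ ->]]]]]]] := wedgeP w.
  by rewrite fsubUset !fsub1set !inE.
rewrite /run foldl_rcons -/(run p) /= => IH.
rewrite /update; case: ifPn => //= /andP[hx xp].
rewrite in_fsetU in_fset_sep in_wedges_through ?fset1U1// IH.
have [wb|wb] := boolP (h (inr w) <= beta); rewrite ?andbF //= ?andbT.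
(* If [x] is an edge of [w], then [w] was not stored before, since [x] is new to [elist]. Otherwise
   adding [x] does not affect the inclusion. *)
have [xw|xw] := boolP (x \in wedge_edges w) => /=.
  have /negbTE-> : ~~ (wedge_edges w `<=` elist (run p)).
    by apply: contra xp => /fsubsetP/(_ _ xw).
  by rewrite andbT.
rewrite orbF; apply/fsubsetP/fsubsetP => wG e ew.
  by rewrite fset1Ur// wG.
by have := wG e ew; rewrite in_fset1U => /predU1P[ex|//]; rewrite -ex ew in xw.
Qed.

Lemma run_bit p w : w \in wlist (run p) -> bit (run p) w = last_closed w p.
Proof.
elim/last_ind: p => // p x; rewrite /run foldl_rcons -/(run p) /= => IH.
rewrite last_closed_rcons => wl; rewrite wl /=.
case: ifP => // _; case: ifPn => // xw.
(* Since [x] is not an edge of [w], this step cannot insert [w]: it was stored earlier and its bit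
   is unchanged. *)
move: wl; rewrite /update; case: ifPn => // /andP[hx xp] /=.
rewrite in_fsetU in_fset_sep.
rewrite in_wedges_through ?fset1U1// (negbTE xw) /= orbF; exact: IH.
Qed.

Lemma run_wlist_sampled p w : wedge_edges w `<=` [fset e in p] ->
  (w \in wlist (run p)) = sampled w.
Proof.
move=> /fsubsetP wp; rewrite run_wlist; congr (_ && _).
apply/fsubsetP/allP => [we e ew|we e ew].
  by have := we e ew; rewrite run_elist => /andP[].
by rewrite run_elist we// andbT; have := wp e ew; rewrite inE.
Qed.

End Run.

(** * Bijection between triangles and wedges whose closing edge came last *)

Section Triangles.
Variable V : choiceType.
Implicit Types (e f c x : edge V) (w : wedge V) (G : {fset edge V}).

Lemma closes_exists w : exists c, closes c w.
Proof.
have [u [v [v' wP]]] := wedgeP w.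
have vv' : #|` [fset v; v']| == 2%N by rewrite cardfs2; case: wP => ->.
by exists (Edge vv'); rewrite (closesE _ wP).
Qed.

Lemma closes_inj c c' w : closes c w -> closes c' w -> c = c'.
Proof.
have [u [v [v' wP]]] := wedgeP w; rewrite !(closesE _ wP) => /eqP cE /eqP cE'.
by apply: edge_inj; rewrite cE.
Qed.

(** The centre [u] lies on both edges of the wedge but not on the closing edge. *)
Lemma closes_notin c w : closes c w -> c \notin wedge_edges w.
Proof.
have [u [v [v' wP]]] := wedgeP w; rewrite (closesE _ wP) => /eqP cE.
case: wP => vv' [e [f [eE fE ->]]].
have ucF : (u \in endpoints c) = false.
  by rewrite cE !inE (negbTE (edge_neq eE)) (negbTE (edge_neq fE)).
by rewrite !inE; apply/norP; split; apply/eqP => cf; move: ucF;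
   rewrite cf ?eE ?fE fset21.
Qed.

Lemma wedge_neq0 w : exists e, e \in wedge_edges w.
Proof.
have [u [v [v' [_ [e [f [_ _ ->]]]]]]] := wedgeP w.
by exists e; rewrite fset21.
Qed.

(** Turns the recursion into a comparison of first positions. An absent edge has index [size r]: an
    absent closing edge makes the strict inequality fail, and an absent edge of [w] counts as
    oldest. *)
Lemma first_closedE w c r : closes c w ->
  first_closed w r = all (fun e => index c r < index e r)%N (wedge_edges w).
Proof.
move=> cw; elim: r => [|x r IH] /=.
  have [e ew] := wedge_neq0 w; apply/esym/negbTE/allPn; exists e => //.
have [xw|xw] := boolP (closes x w).
  rewrite (closes_inj xw cw) eqxx; apply/esym/allP => e ew.
  by case: eqP => // ce; have := closes_notin cw; rewrite ce ew.
have /negbTE-> : x != c by apply: contraNneq xw => ->.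
have [xew|xew] := boolP (x \in wedge_edges w).
  by apply/esym/negbTE/allPn; exists x => //; rewrite eqxx.
rewrite IH; apply: eq_in_all => e ew.
by have /negbTE-> : x != e by apply: contraNneq xew => ->.
Qed.

Lemma last_closedE w c p : closes c w -> last_closed w p =
  all (fun e => index c (rev p) < index e (rev p))%N (wedge_edges w).
Proof. exact: first_closedE. Qed.

Definition wedge_span w : {fset V} := \bigcup_(e <- wedge_edges w) endpoints e.

Lemma wedge_spanE w (u v v' : V) :
  path2 w u v v' -> wedge_span w = [fset u; v; v'].
Proof.
move=> [_ [e [f [eE fE wE]]]]; apply/fsetP => y.
apply/bigfcupP/idP => [[g]|].
  rewrite andbT wE !inE => /orP[]/eqP->; rewrite ?eE ?fE !inE;
    by case/orP=> ->; rewrite ?orbT.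
rewrite wE !inE -orbA => /or3P[]/eqP->; [exists e|exists e|exists f];
  by rewrite ?eE ?fE ?fset21 ?fset22.
Qed.

Lemma edgeP e : exists a b : V, endpoints e = [fset a; b].
Proof.
case: e => /= A A2; have /fset0Pn[a aA] : A != fset0.
  by rewrite -cardfs_eq0 (eqP A2).
have /cardfs1P[b bE] : #|` A `\ a| == 1%N.
  by move: A2; rewrite (cardfsD1 a) aA eqSS.
by exists a, b; rewrite -(fsetD1K aA) bE.
Qed.

(** Three vertices carry only three pairs: the two edges of [w] and its closing edge. *)
Lemma edge_in_span w c e : closes c w -> endpoints e `<=` wedge_span w ->
  e \in wedge_edges w \/ e = c.
Proof.
have [u [v [v' wP]]] := wedgeP w.
rewrite (closesE _ wP) (wedge_spanE wP) => /eqP cE.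
have [a [b abE]] := edgeP e; have := edge_neq abE.
case: wP => vv' [f [g [fE gE ->]]]; rewrite !inE abE fsubUset !fsub1set !inE.
move=> ab /andP[].
have ef x : endpoints e = endpoints x -> e == x by move=> /edge_inj->.
rewrite -!orbA => /or3P[]/eqP Ea /or3P[]/eqP Eb; move: ab abE;
  rewrite Ea Eb ?eqxx// => _ eE;
  by [left; rewrite ef ?eE ?fE// fsetUC | left; rewrite (ef g) ?orbT// eE gE// fsetUC
     | right; apply/eqP/ef; rewrite eE cE// fsetUC].
Qed.

(** Free of the hashes. The powerset of [G] supplies finiteness, and [insub] keeps its members that
    are wedges. *)
Definition closed_wedges G (p : seq (edge V)) : {fset wedge V} :=
  [fset w in pmap insub (enum_fset (fpowerset G)) | last_closed w p].

Lemma in_closed_wedges G p w :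
  (w \in closed_wedges G p) = (wedge_edges w `<=` G) && last_closed w p.
Proof.
rewrite !inE /=; congr (_ && _); rewrite mem_pmap; apply/mapP/idP => [[s]|wG].
  by rewrite fpowersetE => sG; case: insubP => // w' _ wE [->]; rewrite -wE in sG.
by exists (val w); rewrite ?fpowersetE// valK.
Qed.

(** If two such wedges on the same vertices had different closing edges, each closing edge would lie
    in the other wedge and be more recent than the other. So the closing edges agree, and the wedges
    consist of the remaining two pairs. *)
Lemma wedge_span_inj p :
  {in [pred w | last_closed w p] &, injective wedge_span}.
Proof.
move=> w w'; rewrite !inE => wp wp' span_eq.
have [c cw] := closes_exists w; have [c' cw'] := closes_exists w'.
rewrite (last_closedE _ cw) in wp; rewrite (last_closedE _ cw') in wp'.
have edge_span x (y : wedge V) : x \in wedge_edges y -> endpoints x `<=` wedge_span y.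
  by move=> xy; apply: bigfcup_sup.
have closes_span x (y : wedge V) : closes x y -> endpoints x `<=` wedge_span y.
  have [u [v [v' yP]]] := wedgeP y.
  rewrite (closesE _ yP) (wedge_spanE yP) => /eqP->.
  by rewrite fsubUset !fsub1set !inE !eqxx ?orbT.
have cc' : c = c'.
  have [|c'w|//] := @edge_in_span _ _ c' cw; first by rewrite span_eq closes_span.
  have [|cw2|//] := @edge_in_span _ _ c cw'; first by rewrite -span_eq closes_span.
  by have := ltn_trans (allP wp _ c'w) (allP wp' _ cw2); rewrite ltnn.
have sub (y z : wedge V) : closes c y -> closes c z -> wedge_span y = wedge_span z ->
    wedge_edges y `<=` wedge_edges z.
  move=> cy cz yz; apply/fsubsetP => x xy.
  have [|//|xc] := @edge_in_span _ _ x cz; first by rewrite -yz edge_span.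
  by have := closes_notin cy; rewrite -xc xy.
rewrite -cc' in cw'.
by apply: val_inj; apply/eqP; rewrite eqEfsubset /= !sub.
Qed.

Lemma adjacentP G (x y : V) :
  reflect (exists2 e, e \in G & endpoints e = [fset x; y]) (Defs.adjacent G x y).
Proof. by apply: (iffP hasP) => -[e eG /eqP ?]; exists e. Qed.

Lemma trianglesP G (A : {fset V}) :
  reflect ((A `<=` \bigcup_(e <- G) endpoints e /\ #|` A| = 3%N) /\
           {in A &, forall x y : V, x != y -> Defs.adjacent G x y})
          (A \in triangles G).
Proof.
rewrite in_fset_sep fpowersetE; apply: (iffP and3P) => [[AG /eqP A3 /forallP adj]|].
  split=> // x y xA yA xy.
  by have /forallP/(_ [` yA])/implyP := adj [` xA]; apply; rewrite -val_eqE.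
move=> [[-> ->] adj]; split=> //; apply/forallP => x; apply/forallP => y.
by apply/implyP => xy; apply: adj; rewrite ?fsvalP.
Qed.

Lemma closed_wedge_triangle (q : seq (edge V)) w :
  w \in closed_wedges [fset e in q] q ->
  wedge_span w \in triangles [fset e in q].
Proof.
rewrite in_closed_wedges => /andP[/fsubsetP wG].
have [c cw] := closes_exists w; rewrite (last_closedE _ cw) => /allP wc.
(* The index of [c] is strictly below another index, hence below the length, so [c] does occur in
   [q]. *)
have cq : c \in [fset e in q].
  have [e ew] := wedge_neq0 w; rewrite inE /= -mem_rev -index_mem.
  by rewrite (leq_trans (wc e ew))// index_size.
apply/trianglesP.
have [u [v [v' wP]]] := wedgeP w.
have spanE := wedge_spanE wP; rewrite (closesE _ wP) in cw.
case: wP => vv' [e [f [eE fE wE]]].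
have eG : e \in [fset e in q] by rewrite wG// wE fset21.
have fG : f \in [fset e in q] by rewrite wG// wE fset22.
have uv := edge_neq eE; have uv' := edge_neq fE.
split; [split|] => [||x y]; rewrite ?spanE.
- rewrite -spanE; apply/fsubsetP => y /bigfcupP[g /andP[gw _] yg].
  by apply/bigfcupP; exists g; rewrite // andbT wG.
- by rewrite fsetUC cardfsU1 cardfs2 !inE negb_or uv ![v' == _]eq_sym uv' vv'.
rewrite !inE -!orbA => /or3P[]/eqP-> /or3P[]/eqP->; rewrite ?eqxx// => _;
  apply/adjacentP; by [exists e; rewrite // eE// fsetUC | exists f; rewrite // fE// fsetUC
     | exists c; rewrite // (eqP cw)// fsetUC].
Qed.

Lemma cardfs3P (K : choiceType) (A : {fset K}) : #|` A| = 3%N ->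
  exists x y z : K, [/\ A = [fset x; y; z], x != y, x != z & y != z].
Proof.
move=> A3; have /fset0Pn[x xA] : A != fset0 by rewrite -cardfs_eq0 A3.
have A2 : #|` A `\ x| = 2%N by move: A3; rewrite (cardfsD1 x) xA => -[].
have /fset0Pn[y yA] : A `\ x != fset0 by rewrite -cardfs_eq0 A2.
have /cardfs1P[z zE] : #|` A `\ x `\ y| == 1%N.
  by move/eqP: A2; rewrite (cardfsD1 y) yA eqSS.
exists x, y, z.
have AE : A = [fset x; y; z].
  by rewrite -(fsetD1K xA) -(fsetD1K yA) zE fsetUA.
move: A3; rewrite AE fsetUC cardfsU1 cardfs2 !inE negb_or ![z == _]eq_sym.
by case: (x == y); case: (x == z); case: (y == z).
Qed.

Lemma triangle_closed_wedge (q : seq (edge V)) (A : {fset V}) :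
  A \in triangles [fset e in q] ->
  exists2 w, w \in closed_wedges [fset e in q] q & A = wedge_span w.
Proof.
move=> /trianglesP[[_ /cardfs3P[x [y [z [-> xy xz yz]]]]] adj].
have edge_of a b : a \in [fset x; y; z] -> b \in [fset x; y; z] -> a != b ->
    exists2 e : edge V, e \in rev q & endpoints e = [fset a; b].
  move=> aA bA ab; have /adjacentP[e] := adj a b aA bA ab.
  by rewrite inE /= => eq eE; exists e; rewrite // mem_rev.
have [|||c cq cE] := edge_of x y; rewrite ?inE ?eqxx ?orbT//.
have [|||b bq bE] := edge_of x z; rewrite ?inE ?eqxx ?orbT//.
have [|||a aq aE] := edge_of y z; rewrite ?inE ?eqxx ?orbT//.
(* If side [k] is the most recent of the three, the other two sides form the required wedge. *)
have wit (k l m : edge V) (u v v' : V) : endpoints k = [fset v; v'] ->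
    endpoints l = [fset u; v] -> endpoints m = [fset u; v'] ->
    l \in rev q -> m \in rev q ->
    (index k (rev q) < index l (rev q))%N ->
    (index k (rev q) < index m (rev q))%N ->
    exists2 w, w \in closed_wedges [fset e in q] q & [fset u; v; v'] = wedge_span w.
  move=> kE lE mE lq mq kl km.
  have wP : path2 [fset l; m] u v v' by split; [exact: edge_neq kE|exists l, m].
  have w2 : `[< exists u v v', path2 [fset l; m] u v v' >].
    by apply/asboolP; exists u, v, v'.
  pose w := Wedge w2; exists w; last by rewrite (@wedge_spanE w _ _ _ wP).
  have kw : closes k w by rewrite (@closesE _ _ w _ _ _ wP) kE.
  rewrite in_closed_wedges (last_closedE _ kw) /=; apply/andP; split.
    by rewrite fsubUset !fsub1set !inE /= -!(mem_rev q) lq mq.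
  by apply/allP => e; rewrite !inE => /orP[]/eqP->.
have index_neq (k l : edge V) : k \in rev q -> l \in rev q -> k != l ->
    index k (rev q) != index l (rev q).
  by move=> kq lq; apply: contra => /eqP/index_inj->.
have ab : a != b.
  by apply/eqP => E; have := fset21 x z; rewrite -bE -E aE !inE (negbTE xy) (negbTE xz).
have ac : a != c.
  by apply/eqP => E; have := fset21 x y; rewrite -cE -E aE !inE (negbTE xy) (negbTE xz).
have bc : b != c.
  apply/eqP => E; have := fset22 x y; rewrite -cE -E bE !inE eq_sym (negbTE xy).
  by rewrite (negbTE yz).
have := index_neq _ _ aq bq ab; have := index_neq _ _ aq cq ac.
have := index_neq _ _ bq cq bc; rewrite !neq_ltn.
have eyx : [fset y; x] = endpoints c by rewrite cE fsetUC.
have ezx : [fset z; x] = endpoints b by rewrite bE fsetUC.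
have ezy : [fset z; y] = endpoints a by rewrite aE fsetUC.
have wa := wit a c b x y z aE cE bE cq bq.
have wb := wit b c a y x z bE (esym eyx) aE cq aq.
have wc := wit c b a z x y cE (esym ezx) (esym ezy) bq aq.
have Eb : [fset y; x; z] = [fset x; y; z] by rewrite [[fset y; x]]fsetUC.
have Ec : [fset z; x; y] = [fset x; y; z] by rewrite -fsetUA fsetUC.
rewrite Eb in wb; rewrite Ec in wc.
(* Of the eight sign patterns two are cyclic and contradictory; in each of the others one side is
   the most recent. *)
move=> /orP[bc'|cb'] /orP[ac'|ca'] /orP[ab'|ba'].
- exact: wa.
- exact: wb.
- by have := ltn_trans bc' (ltn_trans ca' ab'); rewrite ltnn.
- exact: wb.
- exact: wa.
- by have := ltn_trans cb' (ltn_trans ba' ac'); rewrite ltnn.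
- exact: wc.
- exact: wc.
Qed.

Lemma card_closed_wedges (q : seq (edge V)) :
  #|` closed_wedges [fset e in q] q| = #|` triangles [fset e in q]|.
Proof.
have -> : triangles [fset e in q] =
    [fset wedge_span w | w in closed_wedges [fset e in q] q].
  apply/fsetP => A; apply/idP/imfsetP => [/triangle_closed_wedge[w]|[w wq ->]].
    by exists w.
  exact: closed_wedge_triangle.
apply/esym/eqP/card_in_imfsetP => w w'.
rewrite !in_closed_wedges => /andP[_ wq] /andP[_ wq']; exact: wedge_span_inj wq wq'.
Qed.

(** Lets the part of the stream before the window be forgotten: each wedge of [G] has an edge in
    [q]. *)
Lemma closed_wedges_suffix (G : {fset edge V}) p q : G = [fset e in q] ->
  closed_wedges G (p ++ q) = closed_wedges G q.
Proof.
move=> GE; apply/fsetP => w; rewrite !in_closed_wedges.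
case: (boolP (_ `<=` _)) => //= /fsubsetP wG; rewrite last_closed_cat//.
by have [e ew] := wedge_neq0 w; apply/hasP; exists e => //; have := wG e ew; rewrite GE inE.
Qed.

End Triangles.

(** * Probability of sampling a wedge, and linearity of expectation *)

Section Probability.
Context (d : measure_display) (Omega : measurableType d) (R : realType)
  (P : probability Omega R).

Lemma uniform_prob01_le (a : R) : 0 < a < 1 ->
  uniform_prob (@ltr01 R) `]-oo, a]%classic = a%:E.
Proof.
move=> /andP[a0 a1]; rewrite /uniform_prob integral_uniform_pdf.
have -> : (`]-oo, a] `&` `[0, 1] = `[0, a] :> set R)%classic.
  apply/seteqP; split => x /=; rewrite !in_itv /=; first by move=> [-> /andP[->]].
  by move=> /andP[-> xa]; split=> //=; rewrite (le_trans xa)// ltW.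
rewrite (eq_integral (cst 1%:E)); last first.
  move=> x; rewrite inE /= in_itv /= => /andP[x0 xa].
  by rewrite /uniform_pdf x0 (le_trans xa (ltW a1)) subr0 invr1.
by rewrite integral_cst//= lebesgue_measure_itv/= lte_fin a0 oppr0 adde0 mul1e.
Qed.

Variables (V : choiceType) (hash : (edge V + wedge V)%type -> {RV P >-> R}).
Variables (alpha beta : R).

Definition hash_event (w : wedge V) : set Omega :=
  [set omega | sampled (fun k => hash k omega) alpha beta w].

Let threshold (k : edge V + wedge V) : set R :=
  if k is inl _ then `]-oo, alpha]%classic else `]-oo, beta]%classic.

Let keys (w : wedge V) : {fset edge V + wedge V} :=
  inr w |` [fset inl e | e in wedge_edges w].

(** A finite intersection of preimages, one per hash value involved, is the form that independence
    and measurability apply to. *)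
Lemma hash_eventE w : hash_event w =
  (\bigcap_(k in [set` keys w]) (hash k @^-1` threshold k))%classic.
Proof.
apply/seteqP; split => omega.
  move=> /andP[/allP we wb] k /=; rewrite !inE => /orP[/eqP->|/imfsetP[e ew ->]].
    by rewrite /= in_itv.
  by rewrite /= in_itv /= we.
move=> H; apply/andP; split; last first.
  by have := H (inr w); rewrite /= fset1U1 in_itv; apply.
apply/allP => e ew.
have := H (inl e); rewrite /= in_itv; apply.
by rewrite inE; apply/orP; right; apply/imfsetP; exists e.
Qed.

Lemma measurable_hash_event w : measurable (hash_event w).
Proof.
rewrite hash_eventE; apply: fin_bigcap_measurable => // k _.
apply: measurable_funPTI; case: k => ?; exact: measurable_itv.
Qed.

Hypothesis hash_random : random_hash hash.
Hypotheses (alpha01 : 0 < alpha < 1) (beta01 : 0 < beta < 1).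

Lemma prob_hash_event w : P (hash_event w) = (alpha ^+ 2 * beta)%:E.
Proof.
have [indep unif] := hash_random.
have mthr k : measurable (threshold k) by case: k => ?; exact: measurable_itv.
rewrite hash_eventE indep//.
have Pk k : P (hash k @^-1` threshold k)%classic =
    (if k is inl _ then alpha else beta)%:E.
  have := unif k _ (mthr k); rewrite /distribution /pushforward => ->.
  by case: k => ? /=; rewrite uniform_prob01_le.
under eq_bigr => k _ do rewrite Pk.
rewrite big_fsetU1 /=; last by apply/negP => /imfsetP[].
rewrite big_imfset /=; last by move=> ? ? _ _ [].
have [u [v [v' [vv' [e [f [eE fE ->]]]]]]] := wedgeP w.
(* The two edges are distinct, as [v != v'], so the factor [alpha] appears twice. *)
rewrite big_fsetU1 /= ?big_seq_fset1; last first.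
  rewrite inE; apply/eqP => ef; have := fset22 u v; rewrite -eE ef fE !inE.
  by rewrite (negbTE vv') orbF eq_sym (negbTE (edge_neq eE)).
by rewrite -!EFinM mulrC expr2.
Qed.

Lemma expectation_sum_indic (I : Type) (r : seq I) (A : I -> set Omega) (k : R) :
  0 <= k -> (forall i, measurable (A i)) ->
  ('E_P[fun omega => (k * \sum_(i <- r) \1_(A i) omega)%R] =
   k%:E * \sum_(i <- r) P (A i))%E.
Proof.
move=> k0 mA; rewrite unlock.
under eq_integral do rewrite EFinM -sumEFin.
rewrite ge0_integralZl_EFin//.
- rewrite ge0_integral_sum//.
    by under eq_bigr do rewrite integral_indic// setIT.
  by move=> i; apply/measurable_EFinP; exact: measurable_indic.
- by move=> x _; apply: sume_ge0 => i _; rewrite lee_fin.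
- apply: emeasurable_sum => i; apply/measurable_EFinP; exact: measurable_indic.
Qed.
End Probability.

(** * Unbiasedness of the triangle estimate *)

Lemma sum_fset_bool (R : nzSemiRingType) (K : choiceType) (A : {fset K})
    (P : pred K) :
  \sum_(x <- A) (P x)%:R = #|` [fset x in A | P x]|%:R :> R.
Proof.
rewrite -sum1_size natr_sum -big_fset_condE [RHS]big_mkcond /=.
by apply: eq_bigr => x _; case: (P x).
Qed.

(** Exchanges the two conditions: a random set of wedges weighted by bits becomes a fixed set
    weighted by sampling indicators, to which linearity applies. *)
Lemma That_sampled (R : realType) (V : choiceType) (h : hash_fun R V)
    (alpha beta : R) (dt : nat) (s : seq (edge V)) (t : nat) :
  That h alpha beta dt s t = (alpha ^+ 2 * beta)^-1 *
    \sum_(w <- closed_wedges (window_graph s dt t) (take t s))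
      (sampled h alpha beta w)%:R.
Proof.
rewrite /That !sum_fset_bool; congr (_ * #|` _|%:R); apply/fsetP => w.
rewrite !in_fset_sep in_closed_wedges /wedge_of_graph andbAC.
case: (boolP (_ `<=` _)) => wG; rewrite ?andbF //= andbT.
have wp : wedge_edges w `<=` [fset e in take t s].
  apply: fsubset_trans wG _; apply/fsubsetP => e; rewrite !inE /=.
  exact: mem_drop.
have wl := run_wlist_sampled h alpha beta wp; rewrite [_ \in _]wl andbC.
by case: (boolP (sampled _ _ _ _)) => sw; rewrite ?andbF //= !andbT run_bit ?wl.
Qed.

Theorem theorem3p4 (d : measure_display) (Omega : measurableType d)
    (R : realType) (P : probability Omega R) (V : choiceType)
    (hash : (edge V + wedge V)%type -> {RV P >-> R})
    (hash_random : random_hash hash)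
    (alpha beta : R) (alpha01 : 0 < alpha < 1) (beta01 : 0 < beta < 1)
    (dt : nat) (s : seq (edge V)) (t : nat) (t_time : (1 <= t <= size s)%N) :
  ('E_P[fun omega => That (fun k => hash k omega) alpha beta dt s t] =
   (#|` triangles (window_graph s dt t)|%:R)%:E)%E.
Proof.
have a0 : 0 < alpha by case/andP: alpha01.
have b0 : 0 < beta by case/andP: beta01.
have k0 : 0 < alpha ^+ 2 * beta by rewrite mulr_gt0// exprn_gt0.
have -> : (fun omega => That (fun k => hash k omega) alpha beta dt s t) =
    (fun omega => (alpha ^+ 2 * beta)^-1 *
      \sum_(w <- closed_wedges (window_graph s dt t) (take t s))
        \1_(hash_event hash alpha beta w) omega).
  apply/funext => omega; rewrite That_sampled; congr (_ * _).
  apply: eq_bigr => w _; rewrite indicE; congr (nat_of_bool _)%:R.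
  by apply/idP/idP; rewrite inE.
rewrite expectation_sum_indic ?invr_ge0 ?ltW//; last first.
  by move=> w; exact: measurable_hash_event.
under eq_bigr do rewrite prob_hash_event//.
(* Positions start at 1, so the window is what remains after dropping one edge fewer than its first
   position. *)
rewrite -(cat_take_drop (maxn 1 (t - dt)).-1 (take t s)) closed_wedges_suffix//.
(* The sum is now constant: the number of closed wedges times [alpha ^+ 2 * beta], which the
   normalization cancels. *)
rewrite sumEFin -EFinM big_const_seq count_predT iter_addr_0.
rewrite -[in RHS]card_closed_wedges -[X in _ * X]mulr_natl mulrCA mulVf ?mulr1//.
by rewrite gt_eqF.
Qed.
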